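(* Let $X$ and $Z$ be Banach spaces and $Y$ be a normed space over $\mathbb{K}$. Assume that $A:X\to Y$ and $B:X\to Z$ are bounded linear maps such that $\ker B\subseteq \ker A$ and $B(X)=Z$. Then there exists a unique bounded linear map $C:Z\to Y$ such that $A=C\circ B$.
   Context: $\mathbb{K}$ denotes either the field $\mathbb{R}$ of real numbers or the field $\mathbb{C}$ of complex numbers. $\ker(\cdot)$ denotes the null space of a linear map. *)

(* Defs.v *)
From HB Require Import structures.
From mathcomp Require Import all_boot all_order all_algebra.
From mathcomp Require Import all_classical all_reals all_analysis.
From mathcomp Require Export complex.

Set Implicit Arguments.
Unset Strict Implicit.
Unset Printing Implicit Defensive.

Import Order.TTheory GRing.Theory Num.Theory.
Import numFieldNormedType.Exports.

Local Open Scope ring_scope.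

(* The norm of a [normedModType K] takes its values in [K]; when [K] is [R[i]]
   these are nonnegative reals, and [u <= v] there means that [v - u] is a
   nonnegative real, so the bound below is the usual one for both scalar
   fields. *)
Definition bounded_linear (K : numFieldType) (U V : normedModType K)
    (f : U -> V) : Prop :=
  linear f /\ exists M : K, forall x : U, `|f x| <= M * `|x|.

(* Main.v *)
(* Algebraically, [C z] must be [A x] for any [x] with [B x = z], and
   [ker B `<=` ker A] makes this well defined and linear. Boundedness is the open
   mapping theorem for [B]: every [z] has a preimage of norm at most [c * `|z|].
   A nested-ball argument in [Z] shows that the image of some ball of [X] is dense
   in a ball of [Z], so each [z] has an approximate preimage [x] with
   [`|x| <= k * `|z|] and [`|z - B x| <= `|z| / 2]; iterating on the remainder
   gives a series that converges in [X] to an exact preimage.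
   Of the scalar field only the archimedean property is used, which treats [R] and
   [R[i]] at once. *)

Require Import Defs.
From HB Require Import structures.
From mathcomp Require Import all_boot all_order all_algebra.
From mathcomp Require Import all_classical all_reals all_analysis.
From mathcomp Require Import complex.
From mathcomp Require Import ring.

Set Implicit Arguments.
Unset Strict Implicit.
Unset Printing Implicit Defensive.

Import Order.TTheory GRing.Theory Num.Theory.
Import numFieldNormedType.Exports.

Local Open Scope classical_set_scope.
Local Open Scope ring_scope.

(** The restriction to nonnegative [x] suits [R[i]], where only real elements compare with
    naturals. *)
Definition nat_archimedean (K : numFieldType) : Prop :=
  forall x : K, 0 <= x -> exists n : nat, x <= n%:R.

Lemma realType_archimedean (R : realType) : nat_archimedean R.
Proof. by move=> x /archi_boundP/ltW; exists (Num.bound x). Qed.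

Lemma complex_archimedean (R : realType) : nat_archimedean R[i].
Proof.
move=> x x_ge0; have [n xn] := realType_archimedean (normr_ge0 (complex.Re x)).
exists n; have Imx := ger0_Im x_ge0.
case: x x_ge0 xn Imx => a b /= _ an b0.
by rewrite -[n%:R](rmorph_nat (@real_complex R)) lecE /= b0 eqxx (le_trans (ler_norm a)).
Qed.

Section ArchimedeanScalars.
Variables (K : numFieldType) (archiK : nat_archimedean K).

Lemma div_exp2_lt (c e : K) : 0 <= c -> 0 < e -> exists n : nat, c / 2 ^+ n < e.
Proof.
move=> c_ge0 e_gt0; have [n cen] := archiK (divr_ge0 c_ge0 (ltW e_gt0)).
exists n; rewrite ltr_pdivrMr ?exprn_gt0// mulrC -ltr_pdivrMr//.
by rewrite (le_lt_trans cen)// -natrX ltr_nat ltn_expl.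
Qed.

Lemma le_div_exp2_eq0 (a c : K) :
  0 <= a -> (forall n, a <= c / 2 ^+ n) -> a = 0.
Proof.
move=> a_ge0 ac; apply/eqP; rewrite -[_ == _]negbK; apply/negP => a_neq0.
have a_gt0 : 0 < a by rewrite lt0r a_neq0.
have c_ge0 : 0 <= c by have := le_trans a_ge0 (ac 0%N); rewrite expr0 divr1.
have [n /(le_lt_trans (ac n))] := div_exp2_lt c_ge0 a_gt0.
by rewrite ltxx.
Qed.

(** The steps telescope to [|u (n + m) - u n| <= r n - r (n + m) <= r n], and [r] decays
    geometrically, so [u] is Cauchy. This serves both the nested balls in [Z] and the partial sums
    in [X]. *)
Lemma cvg_shrinking_balls (V : completeNormedModType K) (u : nat -> V)
    (r : nat -> K) :
  (forall n, 0 <= r n) -> (forall n, r n.+1 <= r n / 2) ->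
  (forall n, `|u n.+1 - u n| <= r n - r n.+1) ->
  exists l, forall n, `|l - u n| <= r n.
Proof.
move=> r_ge0 r_half u_step.
have r_exp n : r n <= r 0%N / 2 ^+ n.
  elim: n => [|n IHn]; first by rewrite expr0 divr1.
  rewrite (le_trans (r_half n))// exprSr invfM mulrA.
  by rewrite ler_wpM2r// invr_ge0.
have u_dist n m : `|u (n + m)%N - u n| <= r n.
  suff : `|u (n + m)%N - u n| <= r n - r (n + m)%N.
    by move=> /le_trans; apply; rewrite gerBl.
  elim: m => [|m IHm]; first by rewrite addn0 !subrr normr0.
  rewrite addnS (le_trans (ler_distD (u (n + m)%N) _ _))//.
  rewrite (le_trans (lerD (u_step _) IHm))//.
  by rewrite [X in X <= _](_ : _ = r n - r (n + m).+1)//; ring.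
have /cvg_ex[l ul] : cvg (u @ \oo).
  apply: cauchy_cvg; apply: cauchy_exP => e e_gt0.
  have [n rn] := div_exp2_lt (r_ge0 0%N) e_gt0.
  exists (u n), n => // m /= nm; rewrite -ball_normE /= distrC -(subnKC nm).
  by rewrite (le_lt_trans (u_dist _ _))// (le_lt_trans (r_exp n)).
exists l => n; apply/ler_addgt0Pr => e e_gt0.
have /cvgrPdist_lt/(_ e e_gt0)[m _ lm] := ul.
have /ltW := lm (n + m)%N (leq_addl _ _).
move=> le_e; rewrite (le_trans (ler_distD (u (n + m)%N) _ _))//.
by rewrite addrC lerD.
Qed.

(** The order of [K] may be partial, but positive elements are real and hence comparable. *)
Lemma lower_bound_gt0 (a b : K) : 0 < a -> 0 < b ->
  exists c, [/\ 0 < c, c <= a & c <= b].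
Proof.
move=> a_gt0 b_gt0.
have [ab|/ltW ba] := real_leP (gtr0_real a_gt0) (gtr0_real b_gt0).
  by exists a.
by exists b.
Qed.

(* Nested balls as in Baire's theorem: if every image of a ball were nowhere
   dense, a point of [Z] could be found outside all of them. *)
Lemma image_ball_somewhere_dense (X : normedModType K)
    (Z : completeNormedModType K) (B : X -> Z) :
  range B = setT ->
  exists n (z0 : Z) (r : K), 0 < r /\
    forall w e, `|w - z0| < r -> 0 < e ->
      exists2 x, `|x| <= n%:R & `|w - B x| < e.
Proof.
move=> surjB; apply: contrapT => not_dense.
(* Any ball contains a smaller one that misses the image of the ball of radius [n]. Keeping
   [0 < zr.2] under the existential lets [choice] yield a total function. *)
have refine n (zr : Z * K) : exists ws : Z * K, 0 < zr.2 ->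
    [/\ 0 < ws.2, ws.2 <= zr.2 / 2, `|ws.1 - zr.1| <= zr.2 - ws.2 &
        forall x, `|x| <= n%:R -> ~ `|B x - ws.1| <= ws.2].
  case: zr => z r /=.
  have [r_gt0|] := pselect (0 < r); last by exists (z, r).
  apply: contrapT => no_ws; apply: not_dense.
  exists n, z, (r / 2); split; first by rewrite divr_gt0.
  move=> w e wz e_gt0; apply: contrapT => not_close; apply: no_ws.
  have [||s [s_gt0 sr se]] := @lower_bound_gt0 (r / 2) (e / 2).
  - by rewrite divr_gt0.
  - by rewrite divr_gt0.
  exists (w, s) => _ /=; split => // [|x xn Bxw].
    rewrite (le_trans (ltW wz))// lerBrDr (le_trans (lerD (lexx _) sr))//.
    by rewrite -splitr.
  apply: not_close; exists x => //; rewrite distrC (le_lt_trans Bxw)//.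
  by rewrite (le_lt_trans se)// ltr_pdivrMr// ltr_pMr// ltr1n.
have [f fP] := choice (fun nzr : nat * (Z * K) => refine nzr.1 nzr.2).
pose b := fix b n := if n is m.+1 then f (m, b m) else (0, 1).
have b_gt0 n : 0 < (b n).2.
  by elim: n => [|n IHn] //=; have [] := fP (n, b n) IHn.
have bP n := fP (n, b n) (b_gt0 n).
have [||n|l lb] := @cvg_shrinking_balls Z (fun n => (b n).1) (fun n => (b n).2).
- by move=> n; exact: ltW.
- by move=> n; have [] := bP n.
- by have [] := bP n.
(* For [n] above the norm of [x], the limit [l = B x] lies in ball [n.+1], which was chosen to miss
   it. *)
have [x _ Bxl] : range B l by rewrite surjB.
have [n xn] := archiK (normr_ge0 x).
by have [_ _ _ /(_ x xn)] := bP n; apply; rewrite Bxl; exact: (lb n.+1).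
Qed.

(** A nonzero vector forces [0 <= M], so [M + 1] works; in the zero space [M] is arbitrary and 1 is
    taken. *)
Lemma bounded_linear_gt0 (U V : normedModType K) (f : U -> V) :
  bounded_linear f -> exists2 M : K, 0 < M & forall x, `|f x| <= M * `|x|.
Proof.
move=> [_ [M fM]].
have [[x x_neq0]|all0] := pselect (exists x : U, x != 0).
  exists (M + 1) => [|y].
    rewrite ltr_wpDl// -(pmulr_lge0 _ (_ : 0 < `|x|)) ?normr_gt0//.
    exact: le_trans (fM x).
  by rewrite (le_trans (fM y))// mulrDl lerDl mul1r.
exists 1 => // y; have [->|y0] := eqVneq y 0; last by case: all0; exists y.
by rewrite (le_trans (fM 0))// !normr0 !mulr0.
Qed.

Lemma linear_funB (U V : lmodType K) (f : U -> V) : linear f ->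
  {morph f : x y / x - y}.
Proof. by move=> lf x y; rewrite addrC -scaleN1r lf scaleN1r addrC. Qed.

Lemma linear_fun0 (U V : lmodType K) (f : U -> V) : linear f -> f 0 = 0.
Proof. by move=> /linear_funB/(_ 0 0); rewrite !subrr. Qed.

Lemma linear_funZ (U V : lmodType K) (f : U -> V) : linear f ->
  forall a, {morph f : x / a *: x}.
Proof.
by move=> lf a x; have := lf a x 0; rewrite !addr0 (linear_fun0 lf) addr0.
Qed.

(** Density holds only near [z0], so [z0] and its translate by a rescaled [z] are both approximated;
    subtracting cancels [z0] and doubles the bounds on norm and error. *)
Lemma approximate_preimage (X : normedModType K)
    (Z : completeNormedModType K) (B : X -> Z) :
  linear B -> range B = setT ->
  exists2 k : K, 0 <= k & forall z,
    exists x, `|x| <= k * `|z| /\ `|z - B x| <= `|z| / 2.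
Proof.
move=> linB surjB.
have [n [z0 [r [r_gt0 dense]]]] := image_ball_somewhere_dense surjB.
exists ((n%:R + n%:R) * (2 / r)) => [|z].
  by rewrite mulr_ge0 ?addr_ge0// divr_ge0// ltW.
have [->|z_neq0] := eqVneq z 0.
  by exists 0; rewrite (linear_fun0 linB) subr0 !normr0 mulr0 mul0r.
have z_gt0 : 0 < `|z| by rewrite normr_gt0.
(* With this scale [t^-1 *: z] has norm [r / 2]. *)
pose t := 2 / r * `|z|.
have t_gt0 : 0 < t by rewrite mulr_gt0// divr_gt0.
have t_norm : `|t| = t by rewrite gtr0_norm.
have t_neq0 : t != 0 by rewrite gt_eqF.
have norm_tz : `|t^-1 *: z| < r.
  rewrite normrZ normfV t_norm mulrC ltr_pdivrMr// /t mulrA mulrCA divff.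
    by rewrite mulr1 ltr_pMl// ltr1n.
  by rewrite gt_eqF.
(* Two errors [e], scaled by [t], add up to [|z| / 2]. *)
pose e := `|z| / 2 / 2 / t.
have e_gt0 : 0 < e by rewrite !divr_gt0.
have [|x1 x1n x1e] := dense (z0 + t^-1 *: z) e _ e_gt0.
  by rewrite addrC addKr.
have [|x0 x0n x0e] := dense z0 e _ e_gt0.
  by rewrite subrr normr0.
exists (t *: (x1 - x0)); split.
  rewrite normrZ t_norm -[leRHS]mulrA -/t [leRHS]mulrC.
  by rewrite ler_wpM2l ?(ltW t_gt0)// (le_trans (ler_normB _ _))// lerD.
rewrite (linear_funZ linB) (linear_funB linB).
have -> : z - t *: (B x1 - B x0) =
    t *: ((z0 + t^-1 *: z - B x1) - (z0 - B x0)).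
  rewrite opprB [z0 + _]addrC [_ + z0 - _]addrAC addrACA subrr addr0 -addrA.
  by rewrite [RHS]scalerDr scalerA divff// scale1r -scalerN opprB [- B x1 + _]addrC.
rewrite normrZ t_norm mulrC -ler_pdivlMr//.
rewrite (le_trans (ler_normB _ _))//.
by rewrite (le_trans (lerD (ltW x1e) (ltW x0e)))// /e -mulrDl -splitr.
Qed.

Lemma bounded_preimage (X Z : completeNormedModType K) (B : X -> Z) :
  bounded_linear B -> range B = setT ->
  exists2 c : K, 0 <= c & forall z, exists2 x, B x = z & `|x| <= c * `|z|.
Proof.
move=> bB surjB; have [linB _] := bB.
have [M M_gt0 BM] := bounded_linear_gt0 bB.
have [k k_ge0 approx] := approximate_preimage linB surjB.
have [g gP] := choice approx.
exists (k * 2) => [|z]; first by rewrite mulr_ge0.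
pose rest n := iter n (fun y => y - B (g y)) z.
have rest_le n : `|rest n| <= `|z| / 2 ^+ n.
  elim: n => [|n IHn]; first by rewrite expr0 divr1.
  have [_ /le_trans] := gP (rest n); apply.
  by rewrite exprSr invfM mulrA ler_wpM2r// invr_ge0.
pose s n := \sum_(i < n) g (rest i).
have restE n : rest n = z - B (s n).
  rewrite /s; elim: n => [|n IHn].
    by rewrite big_ord0 (linear_fun0 linB) subr0.
  rewrite big_ord_recr/= [_ + g _]addrC -[g _]scale1r linB !scale1r opprD addrCA.
  by rewrite -IHn addrC.
(* The tail from index [n] of the geometric series with terms [k * |z| / 2 ^+ i], which dominate the
   norms of the corrections [g (rest i)]. *)
pose r n : K := k * 2 * `|z| / 2 ^+ n.
have r_ge0 n : 0 <= r n by rewrite !mulr_ge0// invr_ge0 exprn_ge0.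
have r_half n : r n.+1 = r n / 2 by rewrite /r exprSr invfM mulrA.
have [|n|x xs] := @cvg_shrinking_balls X s r r_ge0.
- by move=> n; rewrite r_half.
- rewrite r_half {1}[r n]splitr addrK /s big_ord_recr/= addrAC subrr add0r.
  have [/le_trans + _] := gP (rest n); apply.
  rewrite /r mulrAC [k * 2 * _]mulrAC mulfK ?pnatr_eq0// -mulrA.
  by rewrite ler_wpM2l.
exists x; last first.
  by have := xs 0%N; rewrite /s big_ord0 subr0 /r expr0 divr1.
apply/esym/eqP; rewrite -subr_eq0 -normr_eq0; apply/eqP.
(* The constant adds the bound for [rest n] to [M] times the bound for [x - s n]. *)
apply: (@le_div_exp2_eq0 _ (`|z| + M * (k * 2 * `|z|))) => // n.
have -> : z - B x = rest n - B (x - s n).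
  by rewrite restE (linear_funB linB) opprB addrA subrK.
rewrite (le_trans (ler_normB _ _))// mulrDl lerD//.
rewrite (le_trans (BM _))// -[leRHS]mulrA (ler_wpM2l (ltW M_gt0))//; exact: xs.
Qed.

Lemma factor_through_surjection (X Z : completeNormedModType K)
    (Y : normedModType K) (A : X -> Y) (B : X -> Z) :
  bounded_linear A -> bounded_linear B ->
  B @^-1` [set 0] `<=` A @^-1` [set 0] -> range B = setT ->
  exists! C : Z -> Y, bounded_linear C /\ A = C \o B.
Proof.
move=> bA bB kerBA surjB; have [[linA _] [linB _]] := (bA, bB).
have [M M_gt0 AM] := bounded_linear_gt0 bA.
have [c c_ge0 preim] := bounded_preimage bB surjB.
have {preim} /choice[g gP] z : exists x, B x = z /\ `|x| <= c * `|z|.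
  by have [x] := preim z; exists x.
have eqA x y : B x = B y -> A x = A y.
  move=> Bxy; apply/eqP; rewrite -subr_eq0 -(linear_funB linA); apply/eqP/kerBA.
  by rewrite /= (linear_funB linB) Bxy subrr.
exists (A \o g); split; last first.
  move=> C' [_ ->]; apply/funext => z /=.
  by have [-> _] := gP z.
split; last by apply/funext => x; apply: eqA; have [-> _] := gP (B x).
(* The section [g] need not be linear; [A \o g] is, because by [eqA] its values do not depend on the
   chosen preimages. *)
split => [a z w|] /=.
  rewrite -linA; apply: eqA; rewrite linB.
  by have [-> _] := gP z; have [-> _] := gP w; have [-> _] := gP (a *: z + w).
exists (M * c) => z; have [_ gz] := gP z.
by rewrite (le_trans (AM _))// -mulrA ler_wpM2l// ltW.
Qed.

End ArchimedeanScalars.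

Theorem theorem1p1 (R : realType) (K : numFieldType)
    (hK : K = R :> numFieldType \/ K = R[i] :> numFieldType)
    (X Z : completeNormedModType K) (Y : normedModType K)
    (A : X -> Y) (B : X -> Z)
    (hA : bounded_linear A) (hB : bounded_linear B)
    (hker : B @^-1` [set 0] `<=` A @^-1` [set 0])
    (hsurj : range B = setT) :
  exists! C : Z -> Y, bounded_linear C /\ A = C \o B.
Proof.
have archiK : nat_archimedean K.
  by case: hK => ->; [exact: realType_archimedean | exact: complex_archimedean].
exact: factor_through_surjection.
Qed.
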